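(* We have $\mathrm{Aut}(H)=\mathrm{Aut}_3(H)\langle\nu\rangle$. In particular, $|\mathrm{Aut}(H)|=2p^{8m}$.
   Context: $p$ is an odd prime, $m\geq 1$ an integer, and $\alpha>1$ an integer with $v_p(\alpha-1)=m$ ($v_p$ is the $p$-adic valuation); if $p=3$ and $m=1$, it is also assumed that $(\alpha-1)/3\equiv 1\bmod 3$. Conventions: $[x,y]=x^{-1}y^{-1}xy$, $x^y=y^{-1}xy$. $H$ is the group (a finite $p$-group of order $p^{6m}$ and nilpotency class 4) $$H=\langle A,B\,|\,A^{[A,B]}=A^\alpha,\ B^{[B,A]}=B^\alpha,\ A^{p^{2m}}=B^{p^{2m}}=1\rangle,$$ and $\nu$ is the automorphism of $H$ interchanging $A$ and $B$. For a group $T$, $1=Z_0(T)\subseteq Z_1(T)=Z(T)\subseteq Z_2(T)\subseteq\cdots$ is the upper central series, and $\mathrm{Aut}_i(T)$ is the kernel of the canonical map $\mathrm{Aut}(T)\to\mathrm{Aut}(T/Z_i(T))$. *)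

(* Defs.v *)
From mathcomp Require Import all_boot all_fingroup all_solvable.

Set Implicit Arguments.
Unset Strict Implicit.
Unset Printing Implicit Defensive.

Local Open Scope group_scope.

(* Aut_i(G), the kernel of the canonical map Aut(G) -> Aut(G / Z_i(G)).  The
   action [Aut G] / 'Z_i(G) lives on the whole type coset_of 'Z_i(G), but an
   element of Aut G is the identity outside G, so it fixes every coset outside
   G / 'Z_i(G); see Aut_ucnP. *)
Definition Aut_ucn (i : nat) (gT : finGroupType) (G : {group gT}) :
    {set {perm gT}} :=
  'ker (actperm ([Aut G] / 'Z_i(G))).

Lemma qact_dom_Aut_ucn (i : nat) (gT : finGroupType) (G : {group gT}) :
  qact_dom [Aut G] 'Z_i(G) = Aut G.
Proof.
rewrite qact_domE ?ucn_sub //; apply/setP=> a.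
apply/idP/idP=> [/setIP[] // | Aa].
rewrite inE Aa inE; apply/subsetP=> x Zx; rewrite inE /=.
have /charP[_ /(_ (autm_morphism Aa))] := ucn_char i G.
move=> /(_ (injm_autm Aa) (im_autm Aa)) imZ.
have Gx := subsetP (ucn_sub i G) x Zx.
by rewrite -imZ; apply: (mem_morphim (autm_morphism Aa) Gx Zx).
Qed.

Lemma Aut_ucnP (i : nat) (gT : finGroupType) (G : {group gT}) (a : {perm gT}) :
  reflect (a \in Aut G /\
           {in G, forall x, coset 'Z_i(G) (a x) = coset 'Z_i(G) x})
          (a \in Aut_ucn i G).
Proof.
rewrite /Aut_ucn ker_actperm; set Z := 'Z_i(G).
have nZG : G \subset 'N(Z) := ucn_norm i G.
have domE : qact_dom [Aut G] Z = Aut G := qact_dom_Aut_ucn i G.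
apply: (iffP setIP) => [[]|[Aa fixa]]; rewrite /= domE.
  move=> Aa cTa; split=> // x Gx.
  have Nx := subsetP nZG x Gx.
  move: cTa; rewrite inE => /subsetP/(_ (coset Z x) (in_setT _)).
  by rewrite inE qactE ?domE // => /eqP.
split=> //; rewrite inE; apply/subsetP=> xb _.
have [x Nx ->] := cosetP xb; rewrite inE /= qactE ?domE //=.
rewrite /autact /= /aperm; case: (boolP (x \in G)) => Gx; first by rewrite fixa.
by apply/eqP; congr (coset Z _); apply: out_Aut Aa Gx.
Qed.

(* G is < A, B | A^[A,B] = A^alpha, B^[B,A] = B^alpha,
   A^(p^(2m)) = B^(p^(2m)) = 1 > and A, B are its given generators.  "\isog Grp"
   only says that G is the largest finite quotient of the presented group; that
   group is finite here, so G is isomorphic to it.  An epimorphism between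
   finite groups of equal order being an isomorphism, the second clause then
   makes the marked group (G, A, B) unique up to isomorphism. *)
Definition presented_by (p m alpha : nat) (gT : finGroupType) (G : {group gT})
    (A B : gT) : Prop :=
  [/\ G :=: <<[set A; B]>>,
      [/\ A ^ [~ A, B] = A ^+ alpha, B ^ [~ B, A] = B ^+ alpha,
          A ^+ (p ^ (2 * m))%N = 1 & B ^+ (p ^ (2 * m))%N = 1]
    & G \isog Grp (a : b : a ^ [~ a, b] = a ^+ alpha,
                           b ^ [~ b, a] = b ^+ alpha,
                           a ^+ (p ^ (2 * m))%N, b ^+ (p ^ (2 * m))%N)].

(* Main.v *)
Require Import Defs.
From HB Require Import structures.
From mathcomp Require Import all_boot all_algebra all_fingroup all_solvable
  zify ring.

(* Write C = [A, B], P = p^m, alpha = 1 + P u with u prime to p, a = A^P,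
   b = B^P and c = C^P.  Conjugating powers of A by B gives (A^k)^B = (A C)^k,
   and <A, C> has class at most 2; hence c is central, a^B = a c, b^A = b c^-1,
   C^(P^2) = 1, and M = <a, b, C> is an abelian normal subgroup that will be
   Z_3(H).  An explicit action on pairs of residues mod P^2 shows that C has
   order exactly P^2, so |M| = P^4.  For all z, w in M the pair (A z, B w)
   again satisfies the relations, so |Aut_3(H)| = |M|^2 = p^(8m).

   Conversely let (X, Y) be the image of (A, B) under an automorphism, with
   X = A^x B^y mod M and Y = A^r B^s mod M.  The commutator W = [X, [X, Y]]
   equals X^(P u), so it commutes with X, and [W, Y] = [X, Y]^(P u).  Comparing
   powers of c gives x y = 0 and x s + y r = 1 mod P, and symmetrically r s = 0;
   up to exchanging A and B, y = r = 0.  Correcting by Aut_3(H) one may take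
   X = A^x, Y = B^s, and the first relation then forces C(s, 2) = 0 mod P,
   hence s = x = 1. *)

Set Implicit Arguments.
Unset Strict Implicit.
Unset Printing Implicit Defensive.

Local Open Scope group_scope.

(** The relations alone, without the universal property, so that images and modifications of the
    generators can be tested against them. *)
Definition macdonald_rel (P u : nat) (gT : finGroupType) (A B : gT) : Prop :=
  [/\ A ^ [~ A, B] = A ^+ (1 + P * u), B ^ [~ B, A] = B ^+ (1 + P * u),
      A ^+ (P * P) = 1 & B ^+ (P * P) = 1].

Lemma macdonald_relC P u (gT : finGroupType) (A B : gT) :
  macdonald_rel P u A B -> macdonald_rel P u B A.
Proof. by case. Qed.

Lemma dvdn_bin2_odd n : odd n -> n %| 'C(n, 2).
Proof. by move=> odd_n; rewrite bin2odd // dvdn_mulr. Qed.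

Lemma conjg_commute (gT : finGroupType) (x y : gT) : commute x y -> x ^ y = x.
Proof. by move=> cxy; rewrite conjgE cxy mulKg. Qed.

Lemma commute_conjg (gT : finGroupType) (x y : gT) : x ^ y = x -> commute x y.
Proof. by move=> xy; apply/commgP/conjg_fixP. Qed.

(** * Relations between A, B and their commutator *)

Section Relations.

Variables (P u : nat) (gT : finGroupType) (A B : gT).
Hypotheses (oddP : odd P) (relAB : macdonald_rel P u A B).

Local Notation C := [~ A, B].
Local Notation a := (A ^+ P).
Local Notation c := ([~ A, B] ^+ P).

Lemma conj_A_C : A ^ C = A * a ^+ u.
Proof. by case: relAB => -> *; rewrite expgD -expgM. Qed.

Lemma a_exp : a ^+ P = 1.
Proof. by case: relAB => _ _ A1 _; rewrite -expgM. Qed.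

Lemma aVu_exp k : P %| k -> (a ^- u) ^+ k = 1.
Proof.
case/dvdnP=> d ->; rewrite expgVn -expgM mulnCA mulnC expgM mulnC expgM.
by rewrite a_exp !expg1n invg1.
Qed.

(** Raising A^C = A a^u to the power P kills the second factor, since a^P = 1. *)
Lemma commute_a_C : commute a C.
Proof.
apply: commute_conjg; rewrite conjXg conj_A_C expgMn; last first.
  exact: commuteX (commuteX _ _).
by rewrite -expgM mulnC expgM a_exp expg1n mulg1.
Qed.

(** C multiplies A by a^u, which C centralizes, so C^k multiplies A by a^(u k); this is trivial for
    k = P. *)
Lemma commute_A_c : commute A c.
Proof.
apply: commute_conjg.
suffices conjAX k : A ^ (C ^+ k) = A * a ^+ (u * k).
  by rewrite conjAX mulnC expgM a_exp expg1n mulg1.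
elim: k => [|k IHk]; first by rewrite conjg1 muln0 mulg1.
rewrite expgSr conjgM {}IHk conjMg conj_A_C conjXg (conjg_commute commute_a_C).
by rewrite -mulgA -expgD mulnS.
Qed.

End Relations.

Section SymmetricRelations.

Variables (P u : nat) (gT : finGroupType) (A B : gT).
Hypotheses (oddP : odd P) (relAB : macdonald_rel P u A B).

Local Notation C := [~ A, B].
Local Notation a := (A ^+ P).
Local Notation b := (B ^+ P).
Local Notation c := ([~ A, B] ^+ P).
Let relBA := macdonald_relC relAB.

Lemma commute_b_C : commute b C.
Proof.
have := commute_a_C relBA; rewrite -(invg_comm A B) => cbC.
by rewrite -[C]invgK; apply: commuteV.
Qed.

Lemma commute_B_c : commute B c.
Proof.
have := commute_A_c relBA; rewrite -(invg_comm A B) expgVn => cBc.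
by rewrite -[c]invgK; apply: commuteV.
Qed.

(* Conjugating A^k by B gives (A C)^k, and <A, C> has class at most 2. *)
Lemma conj_AX_B k :
  (A ^+ k) ^ B = A ^+ k * C ^+ k * (a ^- u) ^+ 'C(k, 2).
Proof.
have CA : [~ C, A] = a ^- u.
  by rewrite -(invg_comm A C) commgEl (conj_A_C relAB) mulKg.
rewrite conjXg conjg_mulR expMg_Rmul CA //.
  by apply: commuteV; apply: commuteX; apply: commute_sym;
    apply: commute_a_C relAB.
exact: commuteV (commuteX _ (commuteX _ (commute_refl A))).
Qed.

(** P is odd, so it divides C(P, 2) and the correction term of [conj_AX_B] vanishes. *)
Lemma conj_a_B : a ^ B = a * c.
Proof.
by rewrite conj_AX_B (aVu_exp relAB) ?mulg1 // dvdn_bin2_odd.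
Qed.

(** Take k = P^2 in [conj_AX_B]: both powers of A are trivial, and so is the correction. *)
Lemma C_exp : C ^+ (P * P) = 1.
Proof.
case: relAB => _ _ A1 _; have := conj_AX_B (P * P).
rewrite A1 conj1g mul1g (aVu_exp relAB) ?mulg1 //.
by apply: (@dvdn_trans (P * P));
  rewrite ?dvdn_mulr // dvdn_bin2_odd // oddM oddP.
Qed.

Lemma c_exp : c ^+ P = 1. Proof. by rewrite -expgM C_exp. Qed.

(** B multiplies a by c, which commutes with B and has c^P = 1; hence B^P fixes a. *)
Lemma commute_a_b : commute a b.
Proof.
apply: commute_conjg.
suffices conjaX k : a ^ (B ^+ k) = a * c ^+ k by rewrite conjaX c_exp mulg1.
elim: k => [|k IHk]; first by rewrite conjg1 mulg1.
rewrite expgSr conjgM {}IHk conjMg conj_a_B conjXg.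
by rewrite (conjg_commute (commute_sym commute_B_c)) -mulgA -expgS.
Qed.

(** The second relation says that C^-1 conjugates B to B b^u; this is that equation solved for
    C^B. *)
Lemma conj_C_B : C ^ B = C * b ^+ u.
Proof.
have := conj_A_C relBA; rewrite -(invg_comm A B) conjgE invgK => BC.
have cbC : commute (b ^+ u) C.
  exact/commute_sym/commuteX/commute_sym/commute_b_C.
by rewrite -cbC conjgE -(mulKg B (b ^+ u)) -BC -!mulgA mulVg mulg1.
Qed.

End SymmetricRelations.

(* Locked: otherwise rewriting with conjMg or mulgA looks inside products. *)
HB.lock Definition abC (P : nat) (gT : finGroupType) (A B : gT) (i j k : nat) :
  gT :=
  A ^+ P ^+ i * B ^+ P ^+ j * [~ A, B] ^+ k.

(** The subgroup M; [ucn3] identifies it with the third term of the upper central series. *)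
Definition macdonald_der (P : nat) (gT : finGroupType) (A B : gT) : {group gT}
  :=
  <<[set A ^+ P; B ^+ P; [~ A, B]]>>%G.

Lemma macdonald_derC P (gT : finGroupType) (A B : gT) : macdonald_der P A B =
  macdonald_der P B A.
Proof.
have sub (X Y : gT) : macdonald_der P X Y \subset macdonald_der P Y X.
  rewrite gen_subG; apply/subsetP=> x; rewrite !inE -orbA => /or3P[] /eqP->.
  - by rewrite mem_gen // !inE eqxx ?orbT.
  - by rewrite mem_gen // !inE eqxx ?orbT.
  by rewrite -invg_comm groupV mem_gen // !inE eqxx ?orbT.
by apply/val_inj/eqP; rewrite eqEsubset !sub.
Qed.

(** * Normal forms a^i b^j C^k in the abelian subgroup M *)

Section AbelianNormalForm.

Variables (P u : nat) (gT : finGroupType) (A B : gT).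
Hypotheses (oddP : odd P) (relAB : macdonald_rel P u A B).

Local Notation C := [~ A, B].
Local Notation a := (A ^+ P).
Local Notation b := (B ^+ P).
Local Notation c := ([~ A, B] ^+ P).
Local Notation abC := (abC P A B).
Local Notation M := (macdonald_der P A B).
Let relBA := macdonald_relC relAB.

Lemma abCM i j k i' j' k' :
  abC i j k * abC i' j' k' = abC (i + i') (j + j') (k + k').
Proof.
have cab := commute_a_b oddP relAB; have caC := commute_a_C relAB.
have cbC := commute_b_C relAB.
have cx := commuteX2 i' j cab; have cy := commuteX2 i' k caC.
have cz := commuteX2 j' k cbC; rewrite abC.unlock !expgD -!mulgA; congr (_ * _).
rewrite (mulgA (C ^+ k)) -cy -mulgA (mulgA (b ^+ j)) -cx -mulgA.
by rewrite (mulgA (C ^+ k)) -cz -!mulgA.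
Qed.

Lemma abC0 : abC 0 0 0 = 1. Proof. by rewrite abC.unlock !mulg1. Qed.

Lemma abCX i j k n : abC i j k ^+ n = abC (i * n) (j * n) (k * n).
Proof.
elim: n => [|n IHn]; first by rewrite !muln0 abC0.
by rewrite expgS IHn abCM -!mulnS.
Qed.

Lemma abC_a i : abC i 0 0 = a ^+ i. Proof. by rewrite abC.unlock !mulg1. Qed.
Lemma abC_b j : abC 0 j 0 = b ^+ j. Proof. by rewrite abC.unlock !mulg1 mul1g.
  Qed.
Lemma abC_C k : abC 0 0 k = C ^+ k. Proof. by rewrite abC.unlock !mul1g. Qed.

Lemma abC_modl i i' j k : abC (i + P * i') j k = abC i j k.
Proof. by rewrite abC.unlock expgD expgM (a_exp relAB) expg1n mulg1. Qed.

Lemma abC_modm i j j' k : abC i (j + P * j') k = abC i j k.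
Proof. by rewrite abC.unlock (expgD b) expgM (a_exp relBA) expg1n mulg1. Qed.

Lemma abC_modr i j k k' : abC i j (k + P * P * k') = abC i j k.
Proof. by rewrite abC.unlock (expgD C) expgM (C_exp oddP relAB) expg1n mulg1.
  Qed.

Lemma abC_in i j k : abC i j k \in M.
Proof.
by rewrite abC.unlock !groupM // groupX // mem_gen // !inE eqxx ?orbT.
Qed.

Lemma mem_macdonald_der z : z \in M -> exists i j k, z = abC i j k.
Proof.
(* Bounded exponents make the normal forms a finite set S. Being closed under products, S is a
   group, and it contains the generators of M. *)
move=> Mz; pose S := [set z | [exists i : 'I_P, exists j : 'I_P,
  exists k : 'I_(P * P), z == abC i j k]].
have P0 : 0 < P by case: P oddP.
have PP0 : 0 < P * P by rewrite muln_gt0 P0.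
have modP i j k : abC i j k \in S.
  rewrite inE; apply/existsP; exists (Ordinal (ltn_pmod i P0)).
  apply/existsP; exists (Ordinal (ltn_pmod j P0)).
  apply/existsP; exists (Ordinal (ltn_pmod k PP0)) => /=.
  rewrite -(abC_modl (i %% P) (i %/ P)) -(abC_modm _ (j %% P) (j %/ P)).
  rewrite -(abC_modr _ _ (k %% _) (k %/ (P * P))).
  by rewrite !(addnC (_ %% _)) !(mulnC _ (_ %/ _)) -!divn_eq.
have Sz x : x \in S -> exists i j k, x = abC i j k.
  rewrite inE => /existsP[i /existsP[j /existsP[k /eqP->]]].
  by exists i, j, k.
apply: (Sz); have gS : group_set S.
  apply/group_setP; split; first by rewrite -abC0 modP.
  move=> x y /Sz[i [j [k ->]]] /Sz[i' [j' [k' ->]]].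
  by rewrite abCM modP.
suffices: M \subset Group gS by move/subsetP; apply.
rewrite gen_subG; apply/subsetP=> x; rewrite !inE -orbA => /or3P[] /eqP->.
- by have := modP 1%N 0 0; rewrite abC_a inE.
- by have := modP 0 1%N 0; rewrite abC_b inE.
by have := modP 0 0 1%N; rewrite abC_C inE.
Qed.

Lemma macdonald_der_abelian : abelian M.
Proof.
apply/centsP=> x /mem_macdonald_der[i [j [k ->]]] y /mem_macdonald_der[i' [j'
  [k' ->]]].
by rewrite /commute !abCM !(addnC i, addnC j, addnC k).
Qed.

Lemma commute_a_c : commute a c.
Proof. exact/commuteX/(commute_a_C relAB). Qed.

Lemma conj_B_a i : B ^ (a ^+ i) = B * c ^- i.
Proof.
have aiB : (a ^+ i) ^ B = a ^+ i * c ^+ i.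
  rewrite conjXg (conj_a_B oddP relAB) expgMn //.
  exact: commute_a_c.
rewrite conjg_mulR -(invg_comm (a ^+ i) B) commgEl aiB; congr (_ * _).
by rewrite mulKg.
Qed.

(** B fixes b, multiplies a by c = C^P and multiplies C by b^u. *)
Lemma conj_abC_B i j k :
  abC i j k ^ B = abC i (j + u * k) (k + P * i).
Proof.
have acE : a * c = abC 1 0 P by rewrite abC.unlock !expg1 mulg1.
have CbE : C * b ^+ u = abC 0 u 1.
  rewrite abC.unlock expg0 mul1g expg1.
  exact (commuteX u (commute_sym (commute_b_C relAB))).
rewrite [in LHS]abC.unlock !conjMg (conjXg C) (conj_C_B relAB) CbE.
rewrite (conjXg a) (conj_a_B oddP relAB) acE (conjg_commute (x := b ^+ j)).
  by rewrite -abC_b !abCX !abCM !(mul0n, mul1n, add0n, addn0) (addnC k).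
exact/commute_sym/commuteX/commuteX.
Qed.

End AbelianNormalForm.

(** * Conjugation between the generators and M *)

Section AbelianNormalFormAction.

Variables (P u : nat) (gT : finGroupType) (A B : gT).
Hypotheses (oddP : odd P) (relAB : macdonald_rel P u A B).

Local Notation C := [~ A, B].
Local Notation a := (A ^+ P).
Local Notation abC := (abC P A B).
Let relBA := macdonald_relC relAB.

(** Conjugate in turn by a^i, which fixes A, by b^j, which contributes C^(P j), and by C^k, which
    contributes a^(u k). *)
Lemma conj_A_abC i j k : A ^ abC i j k = A * abC (u * k) 0 (P * j).
Proof.
rewrite {1}abC.unlock !conjgM (conjg_commute (commuteX i (commuteX P
  (commute_refl A)))).
rewrite (conj_B_a oddP relBA) -(invg_comm A B) !expgVn invgK.
have conjAX : A ^ (C ^+ k) = A * a ^+ (u * k).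
  elim: k => [|k IHk]; first by rewrite conjg1 muln0 mulg1.
  rewrite expgSr conjgM {}IHk conjMg (conj_A_C relAB) conjXg.
  by rewrite (conjg_commute (commute_a_C relAB)) -mulgA -expgD mulnS.
rewrite conjMg conjAX (conjg_commute (x := _ ^+ j)).
  rewrite -mulgA -(expgM C) -(abC_a P A B) -(abC_C P A B (P * j)).
  by rewrite (abCM oddP relAB) addn0.
exact/commute_sym/commuteX/commuteX/commute_sym/commuteX.
Qed.

(** Passing from s to s + 1 adds one factor C and, since C^s becomes C^s b^(u s), adds u s to the
    exponent of b. *)
Lemma conj_A_BX s : A ^ (B ^+ s) = A * abC 0 (u * 'C(s, 2)) s.
Proof.
elim: s => [|s IHs]; first by rewrite conjg1 muln0 abC0 mulg1.
rewrite expgSr conjgM IHs conjMg (conj_abC_B oddP relAB) muln0 addn0 conjg_mulR.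
rewrite -(expg1 C) -(abC_C P A B) -mulgA (abCM oddP relAB) binS bin1.
by rewrite !add0n add1n mulnDr.
Qed.

Lemma conj_B_abC i j k : B ^ abC i j k = B * (abC 0 (u * k) (P * i))^-1.
Proof.
have zB : [~ abC i j k, B] = abC 0 (u * k) (P * i).
  rewrite commgEl (conj_abC_B oddP relAB) -{2}(addn0 i) -(abCM oddP relAB).
  by rewrite mulKg.
by rewrite conjg_mulR -(invg_comm (abC i j k)) zB.
Qed.

Lemma conj_abC_A i j k : abC i j k ^ A = abC i j k * (abC (u * k) 0 (P * j))^-1.
Proof.
by rewrite conjg_mulR -(invg_comm A) commgEl conj_A_abC mulKg.
Qed.

End AbelianNormalFormAction.

(** * Invariance of the relations when A and B are multiplied by elements of M *)

Section Substitution.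

Variables (P u : nat) (gT : finGroupType) (A B : gT).
Hypotheses (oddP : odd P) (relAB : macdonald_rel P u A B).

Local Notation a := (A ^+ P).
Local Notation abC := (abC P A B).
Local Notation M := (macdonald_der P A B).

Lemma conj_abC_abC i j k i' j' k' : abC i j k ^ abC i' j' k' = abC i j k.
Proof.
by rewrite conjg_commute //;
  apply: (centsP (macdonald_der_abelian oddP relAB)); apply: abC_in.
Qed.

Lemma abC_mod i j k i' j' k' :
  abC (i + P * i') (j + P * j') (k + P * P * k') = abC i j k.
Proof.
by rewrite (abC_modl relAB) (abC_modm relAB) (abC_modr oddP relAB).
Qed.

Lemma abC_eq1 i j k : abC (P * i) (P * j) (P * P * k) = 1.
Proof. by have := abC_mod 0 0 0 i j k; rewrite !add0n abC0. Qed.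

(** Write the commutator as X^-1 X^(B w). As M is abelian, conjugation by w acts only on the factor
    A. *)
Lemma commg_subst i j k r s t :
  [~ A * abC i j k, B * abC r s t] = abC (u * t) (u * k) (1 + P * (s + i)).
Proof.
have AB : A ^ B = A * abC 0 0 1 by rewrite conjg_mulR abC_C expg1.
rewrite commgEl conjgM (conjMg A) AB (conj_abC_B oddP relAB) !conjMg.
rewrite (conj_A_abC oddP relAB) !conj_abC_abC invMg -!mulgA mulKg.
rewrite !(abCM oddP relAB) -(mulKg (abC i j k) (abC (u * t) _ _)).
by rewrite (abCM oddP relAB); congr (_ * abC _ _ _); lia.
Qed.

(** [z, A] commutes with z and A, so the only correction is its power C(P, 2). This is trivial
    because P divides C(P, 2) and [z, A]^P = 1. *)
Lemma expP_subst z : z \in M -> (A * z) ^+ P = a * z ^+ P.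
Proof.
case/(mem_macdonald_der oddP relAB)=> i [j [k ->]].
have zA : [~ abC i j k, A] = (abC (u * k) 0 (P * j))^-1.
  by rewrite commgEl (conj_abC_A oddP relAB) mulKg.
have cA : commute A (abC (u * k) 0 (P * j))^-1.
  apply/commuteV; rewrite abC.unlock expg0 mulg1.
  apply: commuteM; first exact/commuteX/commuteX.
  by rewrite expgM; apply/commuteX/(commute_A_c relAB).
have cM : commute (abC i j k) (abC (u * k) 0 (P * j))^-1.
  by apply/commuteV/(centsP (macdonald_der_abelian oddP relAB)); apply: abC_in.
rewrite expMg_Rmul zA //.
have /dvdnP[h ->] := dvdn_bin2_odd oddP.
rewrite expgVn (abCX oddP relAB (u * k)) -[RHS]mulg1; congr (_ * _).
rewrite -invg1 -(abC_eq1 (u * k * h) 0 (j * h)).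
by congr (abC _ _ _)^-1; lia.
Qed.

Lemma conj_subst z w : z \in M -> w \in M ->
  (A * z) ^ [~ A * z, B * w] = (A * z) ^+ (1 + P * u).
Proof.
move=> Mz; have XP := expP_subst Mz; move: Mz XP.
case/(mem_macdonald_der oddP relAB)=> i [j [k ->]] XP /(mem_macdonald_der oddP
  relAB)[r [s [t ->]]].
rewrite commg_subst conjMg (conj_A_abC oddP relAB) conj_abC_abC expgD expg1
  expgM XP.
have aE : a = abC 1 0 0 by rewrite abC_a expg1.
rewrite aE !(abCX oddP relAB) (abCM oddP relAB) (abCX oddP relAB) -!mulgA.
rewrite !(abCM oddP relAB); congr (_ * _).
(* Both sides reduce to this normal form once the exponents of a, b and C are read modulo P, P and
   P^2. *)
transitivity (abC (i + u) j (k + P * (u * k))).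
  by rewrite -(abC_mod (i + u) j (k + P * (u * k)) (u * (s + i)) 0 0);
    congr (abC _ _ _); lia.
by rewrite -(abC_mod (i + u) j (k + P * (u * k)) (u * i) (u * j) 0);
  congr (abC _ _ _); lia.
Qed.

Lemma exp_subst z : z \in M -> (A * z) ^+ (P * P) = 1.
Proof.
move=> Mz; rewrite expgM expP_subst //.
case/(mem_macdonald_der oddP relAB): Mz => i [j [k ->]].
have aE : a = abC 1 0 0 by rewrite abC_a expg1.
rewrite aE !(abCX oddP relAB, abCM oddP relAB) -(abC_eq1 (1 + i * P) (j * P) k).
by congr (abC _ _ _); lia.
Qed.

End Substitution.

(** This supplies one element of Aut_3(H) for each pair (z, w). The relations for B follow from
    those for A by symmetry. *)
Lemma macdonald_rel_subst P u (gT : finGroupType) (A B z w : gT) :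
    odd P -> macdonald_rel P u A B -> z \in macdonald_der P A B -> w \in
      macdonald_der P A B ->
  macdonald_rel P u (A * z) (B * w).
Proof.
move=> oddP relAB Mz Mw; have relBA := macdonald_relC relAB; split.
- exact: (conj_subst oddP relAB Mz Mw).
- by apply: (conj_subst oddP relBA); rewrite macdonald_derC.
- exact: (exp_subst oddP relAB Mz).
by apply: (exp_subst oddP relBA); rewrite macdonald_derC.
Qed.

(** * The order of the commutator *)

Section UniversalProperty.

Variables (p m alpha : nat) (gT rT : finGroupType) (H : {group gT}) (A B : gT).
Hypothesis presH : presented_by p m alpha H A B.

Lemma presented_gen_in : A \in H /\ B \in H.
Proof.
by case: presH => -> _ _; rewrite !mem_gen // !inE eqxx ?orbT.
Qed.

(* The subgroup of H x K generated by (A, X) and (B, Y) satisfies the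
   relations, hence is no larger than H and is the graph of a morphism. *)
Lemma presented_hom (X Y : rT) :
    X ^ [~ X, Y] = X ^+ alpha -> Y ^ [~ Y, X] = Y ^+ alpha ->
    X ^+ (p ^ (2 * m)) = 1 -> Y ^+ (p ^ (2 * m)) = 1 ->
  exists f : {morphism H >-> rT}, f A = X /\ f B = Y.
Proof.
move=> XC YC X1 Y1; have [HA HB] := presented_gen_in.
have [defH [AC BC A1 B1] isoH] := presH.
pose D := <<[set (A, X); (B, Y)]>>%G.
have expD (x : gT) (y : rT) n : (x, y) ^+ n = (x ^+ n, y ^+ n).
  by elim: n => [|n IHn]; rewrite ?expgS ?IHn.
have homD : D \homg H.
  rewrite isoH; apply/existsP; exists ((A, X), (B, Y)) => /=.
  apply/eqP; congr (_, (_, (_, (_, _)))).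
  - by rewrite joing_idl joing_idr.
  - by rewrite expD -AC -XC.
  - by rewrite expD -BC -YC.
  - by rewrite expD A1 X1.
  by rewrite expD B1 Y1.
have imD : [set d.1 | d in D] = H.
  have := morphim_gen (fst_morphism gT rT) (subsetT [set (A, X); (B, Y)]).
  rewrite !morphimEsub ?subsetT //= => ->; rewrite defH.
  by rewrite imsetU1 imset_set1.
have inj1 : {in D &, injective fst}.
  by apply/imset_injP;
    rewrite imD eqn_leq (leq_homg homD) -{1}imD leq_imset_card.
(* The default is reached only outside H, because the first projection maps D onto H. *)
pose f x := (odflt 1 [pick d in D | d.1 == x]).2.
have fD x : x \in H -> (x, f x) \in D.
  rewrite -imD => /imsetP[d Dd ->]; rewrite /f; case: pickP => [e|/(_ d)].
    by case/andP=> De /eqP/= ed; rewrite -ed -surjective_pairing.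
  by rewrite Dd eqxx.
have fE d : d \in D -> f d.1 = d.2.
  move=> Dd; have Hd : d.1 \in H by rewrite -imD imset_f.
  by rewrite -{2}(inj1 _ _ (fD _ Hd) Dd).
have fM : {in H &, {morph f : x y / x * y}}.
  move=> x y Hx Hy /=.
  by rewrite -[RHS](fE ((x, f x) * (y, f y))) // groupM ?fD.
exists (Morphism fM); split; apply: (fE (_, _)).
  by rewrite mem_gen // !inE eqxx.
by rewrite mem_gen // !inE eqxx orbT.
Qed.

End UniversalProperty.

(** * A permutation model in which the commutator is a translation on (k, 0) *)

Section Model.

Local Open Scope ring_scope.
Import GRing.Theory.

Variables (R : finComNzRingType) (q h : R).
Hypotheses (qq : q * q = 0) (h2 : 2 * h = 1).

(* The right action of H on the cosets <A> C^k B^j, written on pairs (k, j);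
   q stands for alpha - 1 and h for 1/2. *)
Definition modelA_fun (v : R * R) : R * R :=
  (v.1 - v.2, v.2 + q * h * (v.2 * (v.2 + 1))).
Definition modelA_inv (v : R * R) : R * R :=
  let j := v.2 - q * h * (v.2 * (v.2 + 1)) in (v.1 + j, j).
Definition modelB_fun (v : R * R) : R * R := (v.1, v.2 + 1).
Definition modelC_fun (v : R * R) : R * R := (v.1 + 1, v.2 * (1 - q)).

(** Turns an identity modulo q^2 into a ring identity; the argument x is the explicit cofactor of
    q^2. *)
Lemma mul_qq x y : y = q * q * x -> y = 0.
Proof. by move=> ->; rewrite qq mul0r. Qed.

Lemma modelA_funK : cancel modelA_fun modelA_inv.
Proof.
case=> k j; rewrite /modelA_fun /modelA_inv /=.
set t := h * (j * (j + 1)); set j2 := _ - q * h * _.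
have -> : j2 = j.
  apply/eqP; rewrite -subr_eq0; apply/eqP.
  apply: (@mul_qq (- h * t * (2 * j + 1) - q * h * t * t)); rewrite /j2 /t;
    ring.
by rewrite subrK.
Qed.

Lemma modelB_funK : cancel modelB_fun (fun v => (v.1, v.2 - 1)).
Proof. by case=> k j; rewrite /modelB_fun /= addrK. Qed.

Lemma modelC_funK : cancel modelC_fun (fun v => (v.1 - 1, v.2 * (1 + q))).
Proof.
case=> k j; rewrite /modelC_fun /= addrK; congr (_, _); apply/eqP.
by rewrite -subr_eq0; apply/eqP/(@mul_qq (- j)); ring.
Qed.

Definition modelA := perm (can_inj modelA_funK).
Definition modelB := perm (can_inj modelB_funK).
Definition modelC := perm (can_inj modelC_funK).

Lemma bin2_half n : 'C(n, 2)%:R = h * n%:R * (n%:R - 1) :> R.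
Proof.
elim: n => [|n IHn]; first by rewrite mulr0 mul0r.
rewrite binS bin1 natrD IHn -natr1.
by transitivity (h * n%:R * (n%:R - 1) + 2 * h * n%:R);
  [rewrite h2 mul1r | ring].
Qed.

(** Modulo q^2 the increment q h j (j + 1) of the second coordinate is constant along the iteration;
    summing it gives the factors n and C(n, 2). *)
Lemma modelAX n k j :
  (modelA ^+ n)%g (k, j) =
  (k - n%:R * j - 'C(n, 2)%:R * (q * h * (j * (j + 1))),
   j + n%:R * (q * h * (j * (j + 1)))).
Proof.
elim: n => [|n IHn]; first by rewrite expg0 perm1 !mul0r !subr0 addr0.
rewrite expgSr permM IHn permE /modelA_fun /= binS bin1 natrD -natr1.
congr (_, _); first by ring.
apply/eqP; rewrite -subr_eq0; apply/eqP.
set t := h * (j * (j + 1)).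
apply: (@mul_qq (h * n%:R * t * (2 * j + 1) + q * h * n%:R * n%:R * t * t)).
by rewrite /t; ring.
Qed.

Lemma modelBX n k j : (modelB ^+ n)%g (k, j) = (k, j + n%:R).
Proof.
elim: n => [|n IHn]; first by rewrite expg0 perm1 addr0.
by rewrite expgSr permM IHn permE /modelB_fun /= -addrA natr1.
Qed.

Lemma modelCX n k : (modelC ^+ n)%g (k, 0) = (k + n%:R, 0).
Proof.
elim: n => [|n IHn]; first by rewrite expg0 perm1 addr0.
by rewrite expgSr permM IHn permE /modelC_fun /= mul0r -addrA natr1.
Qed.

Lemma model_commg : [~ modelA, modelB]%g = modelC.
Proof.
rewrite commgEl conjgE; apply: (mulgI modelA); apply: (mulgI modelB).
rewrite mulKVg mulKVg; apply/permP=> -[k j].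
rewrite !permM !permE /modelA_fun /modelB_fun /modelC_fun /=.
congr (_, _); first by ring.
apply/eqP; rewrite -subr_eq0; apply/eqP.
(* Here h must be one half: the part linear in q cancels only because 2 h = 1. *)
apply: etrans (_ : (1 - 2 * h) * q * (j + 1) + q * q * h * (j + 1) * (j + 2) =
  0).
  by ring.
by rewrite qq h2 subrr !mul0r addr0.
Qed.

Variables (alpha N : nat).
Hypotheses (alphaE : alpha%:R = 1 + q) (N0 : N%:R = 0 :> R).

Lemma modelA_rel : (modelA ^ [~ modelA, modelB] = modelA ^+ alpha)%g.
Proof.
rewrite model_commg conjgE; apply: (mulgI modelC); rewrite mulKVg.
apply/permP=> -[k j]; rewrite !permM !permE /modelC_fun modelAX /modelA_fun /=.
rewrite bin2_half alphaE; congr (_, _); apply/eqP; rewrite -subr_eq0; apply/eqP.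
  pose j0 := j * (1 - q).
  by apply: (@mul_qq (h * (1 + q) * h * (j0 * (j0 + 1)) - j)); rewrite /j0;
    ring.
apply: (@mul_qq (h * (j * j - q * j * j - j * (1 - q) * (j * (1 - q) + 1)))).
by ring.
Qed.

Lemma modelB_rel : (modelB ^ [~ modelB, modelA] = modelB ^+ alpha)%g.
Proof.
rewrite -(invg_comm modelA) model_commg conjgE invgK; apply: (mulIg modelC).
rewrite mulgA mulgKV; apply/permP=> -[k j].
rewrite !permM !permE /modelC_fun modelBX /modelB_fun /= alphaE.
congr (_, _); apply/eqP; rewrite -subr_eq0; apply/eqP.
by apply: (@mul_qq 1); ring.
Qed.

Lemma modelA_exp : (modelA ^+ N = 1)%g.
Proof.
apply/permP=> -[k j]; rewrite modelAX perm1 bin2_half N0.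
by congr (_, _); ring.
Qed.

Lemma modelB_exp : (modelB ^+ N = 1)%g.
Proof. by apply/permP=> -[k j]; rewrite modelBX perm1 N0 addr0. Qed.

Lemma model_commg_exp n : ([~ modelA, modelB] ^+ n = 1)%g -> n%:R = 0 :> R.
Proof.
by rewrite model_commg => /permP/(_ (0, 0)); rewrite modelCX perm1 add0r => -[].
Qed.

End Model.

Section CommutatorOrder.

Variables (p m alpha : nat) (gT : finGroupType) (H : {group gT}) (A B : gT).
Hypotheses (p_pr : prime p) (p_odd : odd p) (m_gt0 : 0 < m).
Hypotheses (valpha : logn p (alpha - 1) = m).
Hypothesis presH : presented_by p m alpha H A B.

Import GRing.Theory.

(** H maps to the model over Z/p^(2m) with q = alpha - 1, whose square vanishes, and h = 1/2,
    available as p is odd. There C^n sends (0, 0) to (n, 0). *)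
Lemma order_commg : p ^ (2 * m) %| #[[~ A, B]].
Proof.
(* As [logn p 0 = 0], a positive valuation excludes the values of alpha for which the truncated
   difference is 0. *)
have alpha_gt1 : 1 < alpha.
  rewrite -subn_gt0 lt0n; apply: contraTneq m_gt0 => alpha1.
  by rewrite -valpha alpha1 logn0.
set N := (p ^ (2 * m))%N; have N_gt1 : 1 < N.
  by rewrite -(exp1n (2 * m)%N) ltn_exp2r ?prime_gt1 // muln_gt0.
have N0 n : (n%:R == 0 :> 'Z_N)%R = (N %| n).
  by rewrite -val_eqE /= val_Zp_nat.
pose q : 'Z_N := ((alpha - 1)%:R)%R.
pose h : 'Z_N := ((2%:R)^-1)%R.
have h2 : (2%:R * h = 1)%R.
  rewrite divrr // unitZpE // coprimeXl //.
  by rewrite coprimen2.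
have qq : (q * q = 0)%R.
  apply/eqP; rewrite /q -natrM N0 /N mul2n -addnn expnD dvdn_mul //.
    by rewrite pfactor_dvdn ?subn_gt0 // valpha.
  by rewrite pfactor_dvdn ?subn_gt0 // valpha.
have alphaE : (alpha%:R = 1 + q)%R.
  by rewrite /q natrB ?(ltnW alpha_gt1) // addrC subrK.
have NN0 : (N%:R = 0 :> 'Z_N)%R by apply/eqP; rewrite N0.
have [f [fA fB]] := presented_hom presH (modelA_rel qq h2 alphaE)
  (modelB_rel qq h2 alphaE) (modelA_exp qq h2 NN0) (modelB_exp NN0).
have [HA HB] := presented_gen_in presH.
rewrite -N0; apply/eqP; apply: (@model_commg_exp _ q h qq h2).
by rewrite -fA -fB -morphR // -morphX ?groupR // expg_order morph1.
Qed.

End CommutatorOrder.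

(** * The upper central series *)

(** In the quotient by Z_n, centralizing S amounts to centralizing the group it generates, so only
    commutators with generators need testing. *)
Lemma gen_ucnS n (gT : finGroupType) (S : {set gT}) (x : gT) :
    x \in <<S>> -> {in S, forall y, [~ x, y] \in 'Z_n(<<S>>)} ->
  x \in 'Z_n.+1(<<S>>).
Proof.
move=> Gx Zxy; rewrite ucnSnR inE Gx /=.
have nZG : <<S>> \subset 'N('Z_n(<<S>>)) by apply: ucn_norm.
have nZS : S \subset 'N('Z_n(<<S>>)) := subset_trans (subset_gen S) nZG.
have nZx : [set x] \subset 'N('Z_n(<<S>>)) by rewrite sub1set (subsetP nZG).
rewrite -quotient_cents2 // quotient_gen // cent_gen quotient_cents2 //.
by rewrite gen_subG; apply/subsetP=> _ /imset2P[_ y /set1P-> Sy ->]; apply: Zxy.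
Qed.

Section Structure.

Variables (P u : nat) (gT : finGroupType) (A B : gT).
Hypotheses (oddP : odd P) (relAB : macdonald_rel P u A B).
Hypotheses (uP : coprime P u) (oC : P * P %| #[[~ A, B]]).

Local Notation C := [~ A, B].
Local Notation a := (A ^+ P).
Local Notation b := (B ^+ P).
Local Notation c := ([~ A, B] ^+ P).
Local Notation abC := (abC P A B).
Local Notation M := (macdonald_der P A B).
Local Notation H := <<[set A; B]>>.
Let relBA := macdonald_relC relAB.

Let HA : A \in H. Proof. by rewrite mem_gen // !inE eqxx. Qed.
Let HB : B \in H. Proof. by rewrite mem_gen // !inE eqxx orbT. Qed.

Lemma P_gt0 : 0 < P. Proof. by case: P oddP. Qed.

Lemma abC_A_norm z : z \in M -> z ^ A \in M.
Proof.
case/(mem_macdonald_der oddP relAB)=> i [j [k ->]].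
by rewrite (conj_abC_A oddP relAB) groupM ?groupV ?abC_in.
Qed.

Lemma abC_B_norm z : z \in M -> z ^ B \in M.
Proof.
by case/(mem_macdonald_der oddP relAB)=> i [j [k ->]];
  rewrite (conj_abC_B oddP relAB) abC_in.
Qed.

Lemma macdonald_der_normal : M <| H.
Proof.
apply/andP; split.
  rewrite gen_subG; apply/subsetP=> x; rewrite !inE -orbA => /or3P[] /eqP->.
  - by rewrite groupX.
  - by rewrite groupX.
  by rewrite groupR.
rewrite gen_subG; apply/subsetP=> x; rewrite 4!inE => /orP[] /eqP->.
  by apply/subsetP=> _ /imsetP[z Mz ->]; apply: abC_A_norm.
by apply/subsetP=> _ /imsetP[z Mz ->]; apply: abC_B_norm.
Qed.

(** M is normal, and A normalizes <B, M> because [B, A] lies in M; hence H is the product of <A>,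
    <B> and M. *)
Lemma mem_macdonald h : h \in H -> exists x y z,
  z \in M /\ h = A ^+ x * B ^+ y * z.
Proof.
have [_ nMH] := andP macdonald_der_normal.
have nMA : <[A]> \subset 'N(M) by rewrite cycle_subG (subsetP nMH).
have nMB : <[B]> \subset 'N(M) by rewrite cycle_subG (subsetP nMH).
have nBMA : <[A]> \subset 'N(<[B]> <*> M).
  rewrite cycle_subG inE -genJ gen_subG; apply/subsetP=> _ /imsetP[y + ->].
  case/setUP=> [/cycleP[n ->] | My].
    rewrite conjXg groupX // conjg_mulR groupM //.
      by apply: (subsetP (joing_subl _ _)); apply: cycle_id.
    apply: (subsetP (joing_subr _ _)); rewrite -invg_comm groupV.
    by rewrite mem_gen // !inE eqxx !orbT.
  by apply: (subsetP (joing_subr _ _)); apply: abC_A_norm.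
have -> : H = <[A]> * (<[B]> * M).
  rewrite -(norm_joinEl nMB) -norm_joinEl // joingA; apply/eqP.
  rewrite eqEsubset; apply/andP; split; last first.
    rewrite join_subG (normal_sub macdonald_der_normal) andbT.
    by rewrite join_subG !cycle_subG HA HB.
  rewrite gen_subG subUset !sub1set; apply/andP; split.
    by apply: (subsetP (joing_subl _ _)); rewrite mem_gen // inE cycle_id.
  by apply: (subsetP (joing_subl _ _)); rewrite mem_gen // inE cycle_id orbT.
case/mulsgP=> _ _ /cycleP[x ->] /mulsgP[_ z /cycleP[y ->] Mz ->] ->.
by exists x, y, z; rewrite mulgA.
Qed.

Lemma c_dvd n : c ^+ n = 1 -> P %| n.
Proof.
move/eqP; rewrite -expgM -order_dvdn => /(dvdn_trans oC).
by rewrite dvdn_pmul2l ?P_gt0.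
Qed.

Lemma abC_conj1 i j k : commute A (abC i j k) -> commute B (abC i j k) ->
  abC (u * k) 0 (P * j) = 1 /\ abC 0 (u * k) (P * i) = 1.
Proof.
move/conjg_commute; rewrite (conj_A_abC oddP relAB) => eA.
move/conjg_commute; rewrite (conj_B_abC oddP relAB) => eB.
split; first by apply: (mulgI A); rewrite eA mulg1.
by apply: invg_inj; apply: (mulgI B); rewrite eB invg1 mulg1.
Qed.

Lemma dvdn_uk k : P %| u * k -> P %| k.
Proof. by rewrite Gauss_dvdr. Qed.

(** Commutators with A and B of a trivial element are trivial. Two rounds leave c^(u k) = 1, so P
    divides k; the first round then yields j and i, and what remains is C^k = 1. *)
Lemma abC_inj1 i j k : abC i j k = 1 -> [/\ P %| i, P %| j & P * P %| k].
Proof.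
move=> m1; have [] := @abC_conj1 i j k; rewrite ?m1; try exact: commute1.
move=> mA mB; have [] := @abC_conj1 (u * k) 0 (P * j); rewrite ?mA;
  try exact: commute1.
move=> _; rewrite abC.unlock mul1g.
rewrite mulnCA (expgM b) (a_exp relBA) expg1n mul1g expgM => /c_dvd/dvdn_uk Pk.
have [k' def_k] := dvdnP Pk.
have ukE : (u * k)%N = (P * (u * k'))%N by rewrite def_k; lia.
move: mA; rewrite abC.unlock expg0 mulg1 ukE.
rewrite (expgM a) (a_exp relAB) expg1n mul1g expgM => /c_dvd Pj.
move: mB; rewrite abC.unlock expg0 mul1g ukE.
rewrite (expgM b) (a_exp relBA) expg1n mul1g expgM => /c_dvd Pi.
split=> //; case/dvdnP: Pi m1 => i' ->; case/dvdnP: Pj => j' ->.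
rewrite abC.unlock !(mulnC _ P) (expgM a) (a_exp relAB) (expgM b) (a_exp relBA).
rewrite !expg1n !mul1g => /eqP; rewrite -order_dvdn; exact: dvdn_trans.
Qed.

(** Consequently a central element of M is a power of c. *)
Lemma abC_central i j k : commute A (abC i j k) -> commute B (abC i j k) ->
  [/\ P %| i, P %| j & P %| k].
Proof.
move=> cA cB; have [] := abC_conj1 cA cB.
move=> /abC_inj1[/dvdn_uk Pk _ Pj] /abC_inj1[_ _ Pi].
by split=> //; rewrite -(dvdn_pmul2l P_gt0).
Qed.

(** By [abC_inj1], M is the direct product of <a>, <b> and <C>, of orders P, P and P^2. *)
Lemma card_macdonald_der : #|M| = (P ^ 4)%N.
Proof.
have cab := commute_a_b oddP relAB.
have TIab : <[a]> :&: <[b]> = 1.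
  apply/trivgP/subsetP=> x /setIP[/cycleP[i ->]].
  rewrite -groupV => /cycleP[j eij].
  have [|/dvdnP[i' ->] _ _] := @abC_inj1 i j 0;
    first by rewrite abC.unlock -eij mulgV mulg1.
  by rewrite mulnC expgM (a_exp relAB) expg1n inE.
have cenab : <[b]> \subset 'C(<[a]>).
  by apply: cents_cycle; apply: commute_sym.
have TIabC : (<[a]> <*> <[b]>) :&: <[C]> = 1.
  apply/trivgP; rewrite /= cent_joinEr //; apply/subsetP=> x.
  case/setIP=> /mulsgP[_ _ /cycleP[i ->] /cycleP[j ->] ->].
  rewrite -groupV => /cycleP[k ek].
  have [|/dvdnP[i' ->] /dvdnP[j' ->] _] := @abC_inj1 i j k.
    by rewrite abC.unlock -ek mulgV.
  rewrite !(mulnC _ P) (expgM a) (a_exp relAB) (expgM b) (a_exp relBA).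
  by rewrite !expg1n mulg1 inE.
have -> : M = (<[a]> <*> <[b]>) * <[C]> :> {set gT}.
  apply/setP=> x; apply/idP/idP.
    case/(mem_macdonald_der oddP relAB)=> i [j [k ->]]; rewrite abC.unlock.
    by rewrite cent_joinEr // !mem_mulg // mem_cycle.
  case/mulsgP=> y _ + /cycleP[k ->] ->; rewrite cent_joinEr //.
  case/mulsgP=> _ _ /cycleP[i ->] /cycleP[j ->] ->.
  by have := abC_in P A B i j k; rewrite abC.unlock.
rewrite (TI_cardMg TIabC) /= cent_joinEr // (TI_cardMg TIab) -![#|<[_]>|]/#[_].
have oa : #[a] = P.
  apply/eqP; rewrite eqn_dvd order_dvdn (a_exp relAB) eqxx /=.
  have [] // := @abC_inj1 #[a] 0 0; first by rewrite abC_a expg_order.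
have ob : #[b] = P.
  apply/eqP; rewrite eqn_dvd order_dvdn (a_exp relBA) eqxx /=.
  have [] // := @abC_inj1 0 #[b] 0; first by rewrite abC_b expg_order.
have -> : #[C] = (P * P)%N.
  by apply/eqP; rewrite eqn_dvd oC order_dvdn (C_exp oddP relAB) eqxx.
by rewrite oa ob !expnS expn0; lia.
Qed.

Lemma c_center : c \in 'Z_1(H).
Proof.
rewrite gen_ucnS ?groupX ?groupR // => y /set2P[]->.
  by rewrite ucn0 inE; apply/commgP/commute_sym/(commute_A_c relAB).
by rewrite ucn0 inE; apply/commgP/commute_sym/(commute_B_c relAB).
Qed.

Lemma a_ucn2 : a \in 'Z_2(H).
Proof.
rewrite gen_ucnS ?groupX // => y /set2P[]->.
  suff -> : [~ a, A] = 1 by apply: group1.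
  exact/eqP/commgP/commute_sym/commuteX.
by rewrite commgEl (conj_a_B oddP relAB) mulKg c_center.
Qed.

Lemma b_ucn2 : b \in 'Z_2(H).
Proof.
rewrite gen_ucnS ?groupX // => y /set2P[]->.
  rewrite commgEl (conj_a_B oddP relBA) mulKg -(invg_comm A) expgVn groupV.
  exact: c_center.
suff -> : [~ b, B] = 1 by apply: group1.
exact/eqP/commgP/commute_sym/commuteX.
Qed.

Lemma C_ucn3 : C \in 'Z_3(H).
Proof.
have Z2 k l : (abC k l 0 \in 'Z_2(H)).
  by rewrite abC.unlock mulg1 groupM // groupX ?a_ucn2 ?b_ucn2.
rewrite gen_ucnS ?groupR // => y /set2P[]->.
  rewrite -(expg1 C) -(abC_C P) commgEl (conj_abC_A oddP relAB) mulKg groupV.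
  by rewrite muln0 Z2.
rewrite -(expg1 C) -(abC_C P A B 1) commgEl (conj_abC_B oddP relAB).
rewrite (_ : abC _ _ (1 + _) = abC 0 0 1 * abC 0 (u * 1) 0) ?mulKg ?Z2 //.
by rewrite (abCM oddP relAB) muln0.
Qed.

Lemma ucn4 : 'Z_4(H) = H.
Proof.
apply/eqP; rewrite eqEsubset ucn_sub gen_subG; apply/subsetP=> x Sx.
apply: gen_ucnS => [|y]; first exact: mem_gen.
case/set2P: Sx => -> /set2P[] ->; rewrite ?commgg ?group1 ?C_ucn3 //.
by rewrite -(invg_comm A) groupV C_ucn3.
Qed.

(** For g in Z_3 the element [A, [A, g]] is central. Its exponent of a is u (P j + y), which P must
    divide by [abC_central]. *)
Lemma ucn3_dvd x y z : z \in M -> A ^+ x * B ^+ y * z \in 'Z_3(H) -> P %| y.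
Proof.
case/(mem_macdonald_der oddP relAB)=> i [j [k ->]] Z3g.
have commZ n g h : g \in 'Z_n.+1(H) -> h \in H -> [~ h, g] \in 'Z_n(H).
  move=> Zg Hh; apply: (subsetP (ucn_comm n [group of H])).
  by rewrite commGC mem_commg.
have := commZ _ _ _ Z3g HA; rewrite commgEl !conjgM.
rewrite (conjg_commute (commuteX x (commute_refl A))) (conj_A_BX oddP relAB).
rewrite conjMg (conj_A_abC oddP relAB) (conj_abC_abC oddP relAB) -mulgA mulKg.
rewrite (abCM oddP relAB) add0n addn0 => /commZ/(_ HA).
rewrite commgEl (conj_A_abC oddP relAB) mulKg => Z1.
have cen h : h \in H -> commute h (abC (u * (P * j + y)) 0 (P * (u * 'C(y,
  2)))).
  by move=> Hh; apply/commgP; have := commZ _ _ _ Z1 Hh; rewrite ucn0 inE.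
have [/dvdn_uk Py _ _] := abC_central (cen _ HA) (cen _ HB).
by move: Py; rewrite dvdn_addr // dvdn_mulr.
Qed.

End Structure.

Lemma ucn3 P u (gT : finGroupType) (A B : gT) :
    odd P -> macdonald_rel P u A B -> coprime P u -> P * P %| #[[~ A, B]] ->
  'Z_3(<<[set A; B]>>) = macdonald_der P A B.
Proof.
move=> oddP relAB uP oC; have relBA := macdonald_relC relAB.
have oC' : P * P %| #[[~ B, A]] by rewrite -invg_comm orderV.
apply/eqP; rewrite eqEsubset; apply/andP; split; last first.
  rewrite gen_subG; apply/subsetP=> x; rewrite !in_setU !in_set1 -orbA.
  case/or3P=> /eqP->; last exact: (C_ucn3 oddP relAB).
    exact: (subsetP (ucn_subS 2 _)) (a_ucn2 oddP relAB).
  exact: (subsetP (ucn_subS 2 _)) (b_ucn2 oddP relAB).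
apply/subsetP=> g Zg; have Hg := subsetP (ucn_sub 3 _) g Zg.
have [x [y [z [Mz def_g]]]] := mem_macdonald oddP relAB Hg.
have /dvdnP[y' def_y] : P %| y by apply: (ucn3_dvd oddP relAB uP oC (x := x)
  Mz); rewrite -def_g.
have My : B ^+ y \in macdonald_der P A B.
  by rewrite def_y mulnC expgM groupX // mem_gen // !inE eqxx orbT.
have Mz' : B ^+ y * z \in macdonald_der P B A by rewrite macdonald_derC groupM.
(* Once B^y is absorbed into M, exchanging A and B makes the same lemma apply to x, with leading
   exponent 0 for B. *)
have /dvdnP[x' def_x] : P %| x.
  apply: (ucn3_dvd oddP relBA uP oC' (x := 0) Mz').
  by rewrite mul1g mulgA -def_g setUC.
rewrite def_g -mulgA groupM // -?(macdonald_derC P B) //.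
by rewrite macdonald_derC def_x mulnC expgM groupX // mem_gen // !inE eqxx.
Qed.

(** * Images of the generators under an automorphism *)

Section Rigidity.

Variables (P u : nat) (gT : finGroupType) (A B : gT).
Hypotheses (oddP : odd P) (relAB : macdonald_rel P u A B).
Hypotheses (uP : coprime P u) (oC : P * P %| #[[~ A, B]]).

Local Notation C := [~ A, B].
Local Notation c := ([~ A, B] ^+ P).
Local Notation abC := (abC P A B).
Local Notation M := (macdonald_der P A B).
Let abCM := abCM oddP relAB.
Let abCX := abCX oddP relAB.

Lemma order_c : #[c] = P.
Proof.
apply/eqP; rewrite eqn_dvd order_dvdn (c_exp oddP relAB) eqxx.
by apply: (c_dvd oddP oC); apply: expg_order.
Qed.

Lemma eq_expc i j : c ^+ i = c ^+ j -> i = j %[mod P].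
Proof. by move/eqP; rewrite eq_expg_mod_order order_c => /eqP. Qed.

Lemma eq_abC i i' j j' k : i = i' %[mod P] -> j = j' %[mod P] ->
  abC i j k = abC i' j' k.
Proof.
move=> ei ej.
rewrite (divn_eq i P) (divn_eq i' P) (divn_eq j P) (divn_eq j' P) ei ej.
rewrite ![(_ %/ P * P + _)%N]addnC !(mulnC _ P).
by rewrite !(abC_modl relAB) !(abC_modm relAB).
Qed.

Lemma commute_A_abC i k : commute A (abC i 0 (P * k)).
Proof.
rewrite abC.unlock expg0 mulg1 expgM; apply: commuteM.
  exact/commuteX/commuteX.
by apply: commuteX; apply: commute_A_c relAB.
Qed.

Lemma commute_B_abC j k : commute B (abC 0 j (P * k)).
Proof.
rewrite abC.unlock expg0 mul1g expgM; apply: commuteM.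
  exact/commuteX/commuteX.
by apply: commuteX; apply: commute_B_c relAB.
Qed.

Lemma commg_AX_abC x i j k : [~ A ^+ x,
  abC i j k] = abC (u * k * x) 0 (P * (j * x)).
Proof.
have AD : [~ A, abC i j k] = abC (u * k) 0 (P * j).
  by rewrite commgEl (conj_A_abC oddP relAB) mulKg.
by rewrite commXg AD ?abCX ?mulnA //; apply: commute_A_abC.
Qed.

Lemma commg_BX_abC y i j k :
  [~ B ^+ y, abC i j k] = (abC 0 (u * k * y) (P * (i * y)))^-1.
Proof.
have BD : [~ B, abC i j k] = (abC 0 (u * k) (P * i))^-1.
  by rewrite commgEl (conj_B_abC oddP relAB) mulKg.
rewrite commXg BD ?expgVn ?abCX ?mulnA //.
by apply: commuteV; apply: commute_B_abC.
Qed.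

Lemma abC_cX j n k : abC (P * j) (P * n) (P * k) = c ^+ k.
Proof.
rewrite (@eq_abC _ 0 _ 0) ?modnMr ?mod0n //.
by rewrite abC_C expgM.
Qed.

(* The right-hand factor c ^+ (j * r) replaces an inverse on the other side. *)
Lemma conj_ucn2 i j k r s w : w \in M ->
  abC i j (P * k) ^ (A ^+ r * B ^+ s * w) * c ^+ (j * r) =
  abC i j (P * k) * c ^+ (i * s).
Proof.
case/(mem_macdonald_der oddP relAB)=> i' [j' [k' ->]].
have xA : abC i j (P * k) ^ (A ^+ r) = abC i j (P * k) * c ^- (j * r).
  rewrite conjg_mulR -(invg_comm (A ^+ r)) commg_AX_abC.
  rewrite (_ : u * (P * k) * r = P * (u * k * r))%N; last by lia.
  by rewrite -(abC_cX (u * k * r) 0) muln0.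
have xB : abC i j (P * k) ^ (B ^+ s) = abC i j (P * k) * c ^+ (i * s).
  rewrite conjg_mulR -(invg_comm (B ^+ s)) commg_BX_abC invgK.
  rewrite (_ : u * (P * k) * s = P * (u * k * s))%N; last by lia.
  by rewrite -(abC_cX 0 (u * k * s)) muln0.
have cB n y : (c ^+ n) ^ (B ^+ y) = c ^+ n.
  by rewrite conjg_commute //;
    apply/commute_sym/commuteX/commute_sym/commuteX/commute_sym/(commute_B_c
      relAB).
rewrite !conjgM xA (conjMg (abC _ _ _)) conjVg cB xB.
have cE n : c ^+ n = abC 0 0 (P * n) by rewrite abC_C expgM.
by rewrite !cE abCM conjMg conjVg !(conj_abC_abC oddP relAB) mulgVK.
Qed.

Lemma rigid x y z r s w :
    let X := A ^+ x * B ^+ y * z in let Y := A ^+ r * B ^+ s * w in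
    z \in M -> w \in M -> macdonald_rel P u X Y -> [~ X, Y] \in M ->
    (forall n, [~ X, Y] ^+ P ^+ n = 1 -> P %| n) ->
  P %| x * y /\ x * s + y * r = 1 %[mod P].
Proof.
move=> X Y Mz Mw relXY MD oD.
have [i [j [d def_D]]] := mem_macdonald_der oddP relAB MD.
have DP : [~ X, Y] ^+ P = c ^+ d.
  by rewrite def_D abCX ![(_ * P)%N]mulnC abC_cX.
(* If gcd(P, d) exceeded 1, the exponent P / gcd(P, d) < P would already kill [X, Y]^P = c^d,
   against the last hypothesis. *)
have dP : coprime P d.
  have Pgt0 := P_gt0 oddP.
  have /oD : [~ X, Y] ^+ P ^+ (P %/ gcdn P d) = 1.
    have /dvdnP[d' def_d] := dvdn_gcdr P d.
    rewrite DP -expgM {1}def_d -mulnA (mulnC (gcdn _ _)) divnK ?dvdn_gcdl //.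
    by rewrite mulnC expgM (c_exp oddP relAB) expg1n.
  move/(dvdn_leq _) => /(_ _);
    rewrite divn_gt0 ?gcdn_gt0 ?Pgt0 // dvdn_leq ?dvdn_gcdl //.
  rewrite /coprime => /(_ isT) leP; apply: contraTT leP => g1; rewrite -ltnNge.
  apply: ltn_Pdiv => //; rewrite ltn_neqAle eq_sym g1 gcdn_gt0 Pgt0 //.
set W := X ^+ (P * u).
have [XD _ _ _] := relXY.
have WE : W = [~ X, [~ X, Y]] by rewrite commgEl XD expgD expg1 mulKg.
(* Up to powers of c, W is a^(u d x) b^(-u d y); the b-part is moved to the left since exponents are
   natural numbers. *)
have [n1 [n2 Wn]] : exists n1 n2,
    W * abC 0 (u * d * y) (P * n2) = abC (u * d * x) 0 (P * n1).
  have NB : [~ A ^+ x, abC i j d] ^ (B ^+ y * z) =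
      abC (u * d * x) 0 (P * (j * x + u * d * x * y)).
    have := conj_ucn2 (u * d * x) 0 (j * x) 0 y Mz.
    rewrite mul0n mulg1 mul1g commg_AX_abC => ->.
    by rewrite -expgM -(abC_C P A B) abCM !addn0 -mulnDr.
  exists (j * x + u * d * x * y)%N, (i * y)%N.
  rewrite WE def_D /X -(mulgA (A ^+ x)) commMgJ NB commMgJ commg_BX_abC.
  have zD : [~ z, abC i j d] = 1.
    by apply/eqP/commgP/(centsP (macdonald_der_abelian oddP relAB));
      rewrite ?abC_in.
  by rewrite zD mulg1 conjVg (conjg_commute (y := z)) ?mulgVK //;
     apply: (centsP (macdonald_der_abelian oddP relAB)); rewrite ?abC_in.
have conjW r' s' w' : w' \in M ->
    W ^ (A ^+ r' * B ^+ s' * w') = W * c ^+ (u * d * (x * s' + y * r')).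
  move=> Mw'; set g := _ * _ * w'.
  have := conj_ucn2 (u * d * x) 0 n1 r' s' Mw';
    rewrite -/g mul0n mulg1 -Wn conjMg.
  have := conj_ucn2 0 (u * d * y) n2 r' s' Mw'; rewrite -/g mul0n mulg1.
  move=> eN eW; apply: (mulIg (abC 0 (u * d * y) (P * n2))).
  rewrite -[in LHS]eN (mulgA (W ^ g)) eW -!mulgA; congr (_ * _).
  have cE n : c ^+ n = abC 0 0 (P * n) by rewrite abC_C expgM.
  rewrite !cE !abCM addn0 add0n; congr (abC _ _ _); first by rewrite addn0.
  by rewrite -mulnDr addnC (mulnDr (u * d)%N) !mulnA.
have cXY : commute (X ^+ P) ([~ X, Y] ^+ P).
  exact/commuteX/(commute_a_C relXY).
have WX : W ^ X = W by rewrite conjg_commute //; apply/commute_sym/commuteX.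
(* This is the rule a^B = a c for the pair (X, Y) itself, raised to the power u. *)
have WY : W ^ Y = W * c ^+ (u * d).
  by rewrite /W expgM conjXg (conj_a_B oddP relXY) expgMn // DP -(expgM c)
    (mulnC u).
have cudP n n' : c ^+ (u * d * n) = c ^+ (u * d * n') -> n = n' %[mod P].
  have cop : coprime P (u * d) by rewrite coprimeMr uP.
  move/eq_expc/eqP => e; apply/eqP; wlog le_nn : n n' e / n' <= n.
    case/orP: (leq_total n' n) => le_nn mono; first exact: mono.
    by rewrite eq_sym; apply: mono => //; rewrite eq_sym.
  move: e; rewrite !eqn_mod_dvd ?leq_mul2l ?le_nn ?orbT //.
  by rewrite -mulnBr Gauss_dvdr.
split.
  (* Comparing W^X = W with [conjW] gives 2 x y = 0 mod P, and P is odd. *)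
  have : c ^+ (u * d * (x * y + y * x)) = c ^+ (u * d * 0).
    by rewrite muln0; apply: (mulgI W); rewrite -(conjW _ _ _ Mz) -/X WX mulg1.
  move/cudP/eqP; rewrite mod0n -/(dvdn _ _) (mulnC y) addnn -mul2n Gauss_dvdr
    //.
  by rewrite coprimen2.
apply: cudP; apply: (mulgI W).
by rewrite -(conjW _ _ _ Mw) -/Y WY muln1.
Qed.

(** The exponents of a on both sides agree because x s = 1. The exponent of C leaves P | u C(s, 2)
    x^2, hence P | s (s - 1), and s is a unit modulo P. *)
Lemma rigid_diagonal x s :
    (A ^+ x) ^ [~ A ^+ x, B ^+ s] = (A ^+ x) ^+ (1 + P * u) ->
    x * s = 1 %[mod P] -> x = 1 %[mod P] /\ s = 1 %[mod P].
Proof.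
move=> relX xs1.
have cop : coprime P (x * s) by rewrite -coprime_modr xs1 coprime_modr
  coprimen1.
have [copx cops] : coprime P x /\ coprime P s by apply/andP; rewrite -coprimeMr.
set t := 'C(s, 2); set m := abC 0 (u * t) s.
have mA : [~ m, A] = (abC (u * s) 0 (P * (u * t)))^-1.
  by rewrite commgEl (conj_abC_A oddP relAB) mulKg.
have comm : [~ A ^+ x,
  B ^+ s] = m ^+ x * (abC (u * s) 0 (P * (u * t))) ^- 'C(x, 2).
  rewrite commgEl conjXg (conj_A_BX oddP relAB) -/t -/m expMg_Rmul mA.
  - by rewrite -mulgA mulKg expgVn.
  - by apply/commuteV; apply: (centsP (macdonald_der_abelian oddP relAB));
    rewrite abC_in.
  exact/commuteV/commute_A_abC.
have AE : A ^ [~ A ^+ x, B ^+ s] = A * abC (u * (s * x)) 0 (P * (u * t * x)).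
  rewrite comm conjgM /m (abCX 0) (conj_A_abC oddP relAB) (conjMg A)
    (@conjg_commute _ A).
    rewrite conjg_commute //; apply/commuteV/commuteX.
    by apply: (centsP (macdonald_der_abelian oddP relAB)); rewrite abC_in.
  exact/commuteV/commuteX/commute_A_abC.
move: relX; rewrite conjXg AE expgMn; last exact: commute_A_abC.
rewrite expgD expg1 -!expgM => /mulgI.
rewrite (mulnCA x) (expgM A) -(abC_a P A B) abCX.
rewrite (@eq_abC _ (x * u) _ 0) //; last first.
  rewrite (_ : u * (s * x) * x = x * u * (x * s))%N; last by lia.
  by rewrite -modnMmr xs1 modnMmr muln1.
have splitC k : abC (x * u) 0 k = abC (x * u) 0 0 * abC 0 0 k by rewrite abCM
  addn0.
rewrite splitC -[in RHS](mulg1 (abC _ _ _)) => /mulgI.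
rewrite abC_C -(mulnA P) expgM => /(c_dvd oddP oC).
rewrite (Gauss_dvdl _ copx) (Gauss_dvdl _ copx) (Gauss_dvdr _ uP) => Pt.
have s1 : s = 1 %[mod P].
  have : P %| t * 2`! by rewrite dvdn_mulr.
  rewrite /t bin_ffact ffactnS ffactn1 Gauss_dvdr //.
  (* For s = 0 coprimality forces P = 1, where every congruence holds; otherwise s - 1 is not
     truncated. *)
  case: (posnP s) cops => [-> | s_gt0 _ Ps].
    by rewrite /coprime gcdn0 => /eqP->; rewrite !modn1.
  by apply/eqP; rewrite eqn_mod_dvd // subn1.
by split=> //; rewrite -xs1 -modnMmr s1 modnMmr muln1.
Qed.

End Rigidity.

(** * The automorphism group *)

Lemma eq_Aut_gen (gT : finGroupType) (S : {set gT}) (f g : {perm gT}) :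
  f \in Aut <<S>> -> g \in Aut <<S>> -> {in S, f =1 g} -> f = g.
Proof.
move=> Af Ag fg; apply: (eq_Aut Af Ag).
suffices /subsetP sub: <<S>> \subset [set x in <<S>> | f x == g x].
  by move=> x /sub; rewrite inE => /andP[_ /eqP].
have gE : group_set [set x in <<S>> | f x == g x].
  apply/group_setP; split.
    rewrite inE group1 -(autmE Af) -(autmE Ag) !morph1 eqxx //.
  move=> x y; rewrite !inE => /andP[Gx /eqP fx] /andP[Gy /eqP fy].
  by rewrite groupM //= -(autmE Af) -(autmE Ag) !morphM //= !autmE fx fy.
rewrite (gen_subG _ (Group gE)); apply/subsetP=> x Sx.
by rewrite inE mem_gen //= fg.
Qed.

(** Since Z_n is normal, the x with x^-1 f(x) in Z_n form a subgroup, so generators suffice. *)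
Lemma mem_Aut_ucn_gen n (gT : finGroupType) (S : {set gT}) (f : {perm gT}) :
  reflect (f \in Aut <<S>> /\ {in S, forall x, x^-1 * f x \in 'Z_n(<<S>>)})
          (f \in Aut_ucn n <<S>>).
Proof.
set Z := 'Z_n(<<S>>); have nZG : <<S>> \subset 'N(Z) := ucn_norm n _.
have cosetE x y : x \in <<S>> -> y \in <<S>> ->
    (coset Z y == coset Z x) = (x^-1 * y \in Z).
  move=> Gx Gy; have Nx := subsetP nZG _ Gx; have Ny := subsetP nZG _ Gy.
  apply/eqP/idP => [e | Zxy].
    by rewrite coset_idr ?groupM ?groupV // morphM ?morphV ?groupV //= e mulVg.
  rewrite -(mulKVg x y) morphM ?groupM ?groupV //= (coset_id Zxy) mulg1 //.
apply: (iffP (Aut_ucnP n [group of <<S>>] f)) => -[Af fZ]; split=> //.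
  move=> x Sx; have Gx := mem_gen Sx; rewrite -cosetE ?(Aut_closed Af) //.
  by apply/eqP/fZ.
have gE : group_set [set x in <<S>> | x^-1 * f x \in Z].
  apply/group_setP; split.
    by rewrite inE group1 -(autmE Af) morph1 mulg1 invg1 group1.
  move=> x y; rewrite !inE => /andP[Gx Zx] /andP[Gy Zy]; rewrite groupM //=.
  rewrite -(autmE Af) morphM //= autmE invMg.
  rewrite (_ : _ * _ = (x^-1 * f x) ^ y * (y^-1 * f y)).
    by rewrite groupM // memJ_norm // (subsetP nZG).
  by rewrite conjgE !mulgA mulgK.
have /subsetP sub : <<S>> \subset [set x in <<S>> | x^-1 * f x \in Z].
  rewrite (gen_subG _ (Group gE)); apply/subsetP=> x Sx.
  by rewrite inE mem_gen //= fZ.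
move=> x Gx; have := sub x Gx; rewrite inE Gx /= => Zx.
by apply/eqP; rewrite cosetE ?(Aut_closed Af).
Qed.

Section Automorphisms.

Variables (P u : nat) (gT : finGroupType) (A B : gT).
Hypotheses (oddP : odd P) (relAB : macdonald_rel P u A B).
Hypotheses (uP : coprime P u) (oC : P * P %| #[[~ A, B]]).

Local Notation c := ([~ A, B] ^+ P).
Local Notation abC := (abC P A B).
Local Notation M := (macdonald_der P A B).
Local Notation H := <<[set A; B]>>.

Hypothesis homH : forall X Y : gT, macdonald_rel P u X Y ->
  exists f : {morphism H >-> gT}, f A = X /\ f B = Y.

Let HA : A \in H. Proof. by rewrite mem_gen // !inE eqxx. Qed.
Let HB : B \in H. Proof. by rewrite mem_gen // !inE eqxx orbT. Qed.
Let Z3 : 'Z_3(H) = M. Proof. exact: (ucn3 oddP relAB uP oC). Qed.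
Let sMH : M \subset H. Proof. exact: normal_sub (macdonald_der_normal oddP
  relAB). Qed.

(* A nontrivial normal subgroup of the nilpotent group H meets the centre <c>,
   so injectivity need only be tested on <c>. *)
Lemma exists_Aut X Y : X \in H -> Y \in H -> macdonald_rel P u X Y ->
    (forall n, [~ X, Y] ^+ P ^+ n = 1 -> P %| n) ->
  exists2 f : {perm gT}, f \in Aut H & f A = X /\ f B = Y.
Proof.
move=> HX HY relXY oXY; have [f [fA fB]] := homH relXY.
have nilH : nilpotent H by apply/ucnP; exists 4; apply: ucn4 relAB.
have injf : 'injm f.
  apply/trivgP; apply: (TI_center_nil nilH (ker_normal f)).
  apply/trivgP/subsetP=> x /setIP[/morphpreP[Hx] /set1P fx Zx].
  have : x \in M.
    rewrite -Z3; apply: (subsetP (ucn_sub_geq _ (isT : 1 <= 3))).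
    by rewrite ucn1.
  case/(mem_macdonald_der oddP relAB)=> i [j [k def_x]].
  have /centerP[_ cenx] := Zx.
  have [||Pi Pj /dvdnP[k' def_k]] := abC_central oddP relAB uP oC (i := i) (j
    := j) (k := k).
  - by rewrite -def_x; apply/commute_sym/cenx.
  - by rewrite -def_x; apply/commute_sym/cenx.
  move: def_x fx; have /dvdnP[i' ->] := Pi; have /dvdnP[j' ->] := Pj.
  rewrite def_k !(mulnC _ P) (abC_cX relAB) => -> fx.
  have : [~ X, Y] ^+ P ^+ k' = 1.
    by rewrite -fA -fB -morphR // -!morphX ?groupX ?groupR.
  move/oXY => /dvdnP[k2 ->]; rewrite mulnC expgM (c_exp oddP relAB) expg1n.
  exact: group1.
have imf : f @* H = H.
  apply/eqP; rewrite eqEcard card_injm // leqnn andbT morphim_gen ?subset_gen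
    //.
  rewrite gen_subG morphimEsub ?subset_gen // imsetU1 imset_set1 fA fB.
  by apply/subsetP=> x /set2P[] ->.
exists (aut injf imf); first exact: Aut_aut.
by rewrite !autE.
Qed.

Lemma exists_swap : exists2 f : {perm gT}, f \in Aut H & f A = B /\ f B = A.
Proof.
apply: exists_Aut => //; first exact: macdonald_relC.
move=> n; rewrite -invg_comm !expgVn => /eqP.
by rewrite invg_eq1 => /eqP; apply: c_dvd.
Qed.

Lemma exists_Aut3 z w : z \in M -> w \in M ->
  exists2 f : {perm gT}, f \in Aut_ucn 3 H & f A = A * z /\ f B = B * w.
Proof.
move=> Mz Mw.
have [||n|f Af [fA fB]] := exists_Aut _ _ (macdonald_rel_subst oddP relAB Mz
  Mw).
- by rewrite groupM // (subsetP sMH).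
- by rewrite groupM // (subsetP sMH).
- case/(mem_macdonald_der oddP relAB): Mz => i [j [k ->]];
  case/(mem_macdonald_der oddP relAB): Mw => r [s [t ->]].
  (* The P-th power of [A z, B w] is again c, so the injectivity test is the one for (A, B). *)
  rewrite (commg_subst oddP relAB) (abCX oddP relAB) mulnDl mul1n.
  have -> : abC (u * t * P) (u * k * P) (P + P * (s + i) * P) = abC 0 0 P.
    rewrite -(abC_mod oddP relAB 0 0 P (u * t) (u * k) (s + i)).
    by congr (abC _ _ _); lia.
  rewrite abC_C; exact: c_dvd.
exists f => //; apply/mem_Aut_ucn_gen; split=> // x; rewrite Z3.
by case/set2P=> ->; rewrite ?fA ?fB mulKg.
Qed.

(** An element f is determined by the pair (A^-1 f(A), B^-1 f(B)) in M x M, and [exists_Aut3]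
    realizes every pair. *)
Lemma card_Aut3 : #|Aut_ucn 3 H| = (#|M| ^ 2)%N.
Proof.
pose phi (f : {perm gT}) := (A^-1 * f A, B^-1 * f B).
have injphi : {in Aut_ucn 3 H &, injective phi}.
  move=> f g /mem_Aut_ucn_gen[Af _] /mem_Aut_ucn_gen[Ag _] [/mulgI eA /mulgI
    eB].
  by apply: (eq_Aut_gen Af Ag) => x /set2P[] ->.
rewrite -(card_in_imset injphi) expnS expn1 -cardsX; congr #|pred_of_set _|.
apply/setP=> -[z w]; rewrite in_setX; apply/imsetP/andP => [[f] | [Mz Mw]].
  case/mem_Aut_ucn_gen=> _ fM [-> ->]; rewrite -Z3.
  by rewrite !fM // !inE eqxx ?orbT.
have [f f3 [fA fB]] := exists_Aut3 Mz Mw; exists f => //.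
by rewrite /phi fA fB !mulKg.
Qed.

Lemma Aut_macdonald_der f z : f \in Aut H -> z \in M -> f z \in M.
Proof.
rewrite -Z3 => Af Zz;
  have /charP[_ /(_ (autm_morphism Af))] := ucn_char 3 [group of H].
move=> /(_ (injm_autm Af) (im_autm Af)) imZ.
have Hz := subsetP (ucn_sub 3 _) z Zz.
by have := mem_morphim (autm_morphism Af) Hz Zz; rewrite imZ.
Qed.

Lemma Aut_rel f : f \in Aut H ->
  [/\ macdonald_rel P u (f A) (f B), [~ f A, f B] \in M
    & forall n, [~ f A, f B] ^+ P ^+ n = 1 -> P %| n].
Proof.
move=> Af; have [AC BC A1 B1] := relAB.
have fX x n : x \in H -> f (x ^+ n) = f x ^+ n.
  by move=> Hx; rewrite -(autmE Af) morphX.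
have fR x y : x \in H -> y \in H -> f [~ x, y] = [~ f x, f y].
  by move=> Hx Hy; rewrite -(autmE Af) morphR.
have fJ x y : x \in H -> y \in H -> f (x ^ y) = f x ^ f y.
  by move=> Hx Hy; rewrite -(autmE Af) morphJ.
have f1 : f 1 = 1 by rewrite -(autmE Af) morph1.
split.
- by split; rewrite -?fR ?fX -?fJ ?groupR ?AC ?BC ?A1 ?B1 // -?fX ?f1 ?A1 ?B1
  ?f1.
- by rewrite -fR //; apply: Aut_macdonald_der => //;
  rewrite mem_gen // !inE eqxx orbT.
move=> n; rewrite -fR // -!fX ?groupX ?groupR // -f1 => /perm_inj.
exact: c_dvd.
Qed.

Lemma Aut_diagonal f x s z w : 1 < P -> f \in Aut H -> z \in M -> w \in M ->
    f A = A ^+ x * z -> f B = B ^+ s * w -> x * s = 1 %[mod P] ->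
  f \in Aut_ucn 3 H.
Proof.
move=> P_gt1 Af Mz Mw fA fB xs1; have AVf := groupVr Af.
(* In [g * f] the factor g acts first, so it must multiply A by the preimage under f of z^-1 for f
   to cancel z; likewise for B and w. *)
have Mz' := Aut_macdonald_der AVf (groupVr Mz);
  have Mw' := Aut_macdonald_der AVf (groupVr Mw).
have [g g3 [gA gB]] := exists_Aut3 Mz' Mw'.
have [Ag _] := mem_Aut_ucn_gen _ _ _ g3.
have fM y v : y \in H -> v \in M -> f (y * (f^-1 v^-1)) = f y * v^-1.
  move=> Hy Mv; rewrite -(autmE Af) morphM //= ?autmE ?permKV //.
  by rewrite (Aut_closed AVf) // groupV (subsetP sMH).
have gfA : (g * f) A = A ^+ x by rewrite permM gA fM // fA mulgK.
have gfB : (g * f) B = B ^+ s by rewrite permM gB fM // fB mulgK.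
have Agf : g * f \in Aut H by rewrite groupM.
have [[+ _ _ _] _ _] := Aut_rel Agf; rewrite gfA gfB => /rigid_diagonal.
case/(_ oddP relAB uP oC xs1) => x1 s1.
have XM h n : h \in H -> h ^+ P \in M -> n = 1 %[mod P] -> h^-1 * h ^+ n \in M.
  move=> Hh Mh n1; rewrite (divn_eq n P) n1 modn_small // addn1 expgS mulKg.
  by rewrite mulnC expgM groupX.
have gf3 : g * f \in Aut_ucn 3 H.
  apply/mem_Aut_ucn_gen; split=> // h; rewrite Z3 => /set2P[] ->.
    by rewrite gfA XM // mem_gen // !inE eqxx.
  by rewrite gfB XM // mem_gen // !inE eqxx orbT.
by rewrite -(mulKg g f) groupM ?groupV.
Qed.

End Automorphisms.

(** * Exponents modulo a prime power *)

Section Exponents.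

Local Open Scope nat_scope.

(** Not both x and y are divisible by p. If p does not divide x, then p^m | y, so x s = 1, s is a
    unit and p^m | r; the other case is symmetric. *)
Lemma rigid_exponents p m x y r s : prime p -> 0 < m ->
    p ^ m %| x * y -> p ^ m %| r * s -> x * s + y * r = 1 %[mod p ^ m] ->
  [/\ p ^ m %| y, p ^ m %| r & x * s = 1 %[mod p ^ m]] \/
  [/\ p ^ m %| x, p ^ m %| s & y * r = 1 %[mod p ^ m]].
Proof.
move=> p_pr m_gt0; have p_dv : p %| p ^ m by rewrite dvdn_exp.
have unit1 n k : n * k = 1 %[mod p ^ m] -> coprime (p ^ m) n.
  move=> nk; have : coprime (p ^ m) (n * k).
    by rewrite -coprime_modr nk coprime_modr coprimen1.
  by rewrite coprimeMr => /andP[].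
have dv0 n : p ^ m %| n -> forall k, k + n = k %[mod p ^ m].
  by move=> /eqP n0 k; rewrite -modnDmr n0 addn0.
have [cpx | ncpx] := boolP (coprime p x) => Pxy Prs e.
  left; have Py : p ^ m %| y by move: Pxy; rewrite Gauss_dvdr // coprimeXl.
  have xs1 : x * s = 1 %[mod p ^ m] by rewrite -e (dv0 (y * r)) // dvdn_mulr.
  split=> //; move: Prs; rewrite Gauss_dvdl // (unit1 s x) // mulnC.
  exact: xs1.
right; move: ncpx; rewrite prime_coprime // negbK => px.
have cpy : coprime p y.
  rewrite prime_coprime //; apply/negP=> py.
  have : p %| (x * s + y * r) by rewrite dvdn_add ?dvdn_mulr.
  rewrite /dvdn -(modn_dvdm _ p_dv) e (modn_dvdm _ p_dv) -/(dvdn p 1) dvdn1.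
  by move/eqP=> p1; rewrite p1 in p_pr.
have Px : p ^ m %| x by move: Pxy; rewrite Gauss_dvdl // coprimeXl.
have yr1 : y * r = 1 %[mod p ^ m].
  by rewrite -e addnC (dv0 (x * s)) // dvdn_mulr.
split=> //; move: Prs; rewrite Gauss_dvdr // (unit1 r y) // mulnC.
exact: yr1.
Qed.

End Exponents.

(** * The factorization of Aut(H) and its order *)

Theorem theorem3p5 (p m alpha : nat) (p_pr : prime p) (p_odd : odd p)
    (m_ge1 : (1 <= m)%N) (alpha_gt1 : (1 < alpha)%N)
    (valpha : logn p (alpha - 1) = m)
    (alpha3 : p = 3 -> m = 1%N -> ((alpha - 1) %/ 3)%N = 1 %[mod 3])
    (gT : finGroupType) (H : {group gT}) (A B : gT)
    (presH : presented_by p m alpha H A B) :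
  (exists nu : {perm gT},
     [/\ nu \in Aut H, nu A = B, nu B = A & Aut H = Aut_ucn 3 H * <[nu]>])
  /\ #|Aut H| = (2 * p ^ (8 * m))%N.
Proof.
pose P := (p ^ m)%N; have [defH [AC BC A1 B1] _] := presH.
have alpha_gt1' : 0 < alpha - 1 by rewrite subn_gt0.
have /dvdnP[u def_u] : P %| alpha - 1 by rewrite pfactor_dvdn // valpha.
have alphaE : alpha = (1 + P * u)%N by rewrite mulnC -def_u subnKC // ltnW.
have pu : coprime p u.
  rewrite prime_coprime //; apply/negP=> /dvdnP[v def_v].
  have : p ^ m.+1 %| alpha - 1 by rewrite def_u def_v -mulnA -expnS dvdn_mull.
  by rewrite pfactor_dvdn // valpha ltnn.
have uP : coprime P u by rewrite coprimeXl.
have oddP : odd P by rewrite oddX p_odd orbT.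
have P_gt1 : 1 < P by rewrite -(exp1n m) ltn_exp2r ?prime_gt1.
have PP : (p ^ (2 * m) = P * P)%N by rewrite mul2n -addnn expnD.
have relE (rT : finGroupType) (X Y : rT) : macdonald_rel P u X Y <->
    [/\ X ^ [~ X, Y] = X ^+ alpha, Y ^ [~ Y, X] = Y ^+ alpha,
        X ^+ (p ^ (2 * m)) = 1 & Y ^+ (p ^ (2 * m)) = 1].
  by rewrite alphaE PP.
have relAB : macdonald_rel P u A B by apply/relE.
have oC : P * P %| #[[~ A, B]] by rewrite -PP; apply: order_commg presH.
have defG : H = <<[set A; B]>>%G by apply: val_inj.
have homH (X Y : gT) : macdonald_rel P u X Y ->
    exists f : {morphism <<[set A; B]>> >-> gT}, f A = X /\ f B = Y.
  by case/relE=> *; rewrite defG in presH;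
    apply: presented_hom presH _ _ _ _ _ _.
rewrite {presH defH}defG /=; set G := <<[set A; B]>>.
have [nu Anu [nuA nuB]] := exists_swap oddP relAB uP oC homH.
have nu2 : nu ^+ 2 = 1.
  apply: (eq_Aut_gen (groupX _ Anu) (group1 _)) => x /set2P[] ->.
    by rewrite permM nuA nuB perm1.
  by rewrite permM nuB nuA perm1.
(* Otherwise A^-1 B lies in M and commutes with a; then so does B, and a^B = a c gives c = 1. *)
have nu_nAut3 : nu \notin Aut_ucn 3 G.
  apply/negP=> /mem_Aut_ucn_gen[_ /(_ A (set21 A B))].
  rewrite nuA (ucn3 oddP relAB uP oC) => /(centsP (macdonald_der_abelian oddP
    relAB)).
  move=> /(_ (A ^+ P)); rewrite mem_gen ?inE ?eqxx // => /(_ isT) cABa.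
  have cBa : commute (A ^+ P) B.
    rewrite -(mulKVg A B); apply: commuteM; last exact: commute_sym.
    exact/commute_sym/commuteX.
  have := conj_a_B oddP relAB; rewrite (conjg_commute cBa) => /eqP.
  rewrite -[X in X == _]mulg1 (inj_eq (mulgI _)) eq_sym => /eqP c1.
  have := c_dvd oddP oC (n := 1); rewrite expg1 c1 => /(_ erefl).
  by rewrite dvdn1 => /eqP P1; rewrite P1 in P_gt1.
have AutE : Aut G = Aut_ucn 3 G * <[nu]>.
  apply/eqP; rewrite eqEsubset; apply/andP; split; last first.
    rewrite mul_subG ?cycle_subG //.
    by apply/subsetP=> f /mem_Aut_ucn_gen[].
  apply/subsetP=> f Af; have [relf fM fP] := Aut_rel oddP relAB uP oC Af.
  have GA : A \in G by rewrite mem_gen // !inE eqxx.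
  have GB : B \in G by rewrite mem_gen // !inE eqxx orbT.
  have [x [y [z [Mz fA]]]] := mem_macdonald oddP relAB (Aut_closed Af GA).
  have [r [s [w [Mw fB]]]] := mem_macdonald oddP relAB (Aut_closed Af GB).
  have [] := rigid oddP relAB uP oC (x := x) (y := y) (r := r) (s := s) Mz Mw;
    rewrite -?fA -?fB // => Pxy e.
  (* Applied to the exchanged pair (f(B), f(A)), the same lemma gives r s = 0 mod P. *)
  have [] := rigid oddP relAB uP oC (x := r) (y := s) (r := x) (s := y) Mw Mz.
  - by rewrite -fA -fB; apply: macdonald_relC.
  - by rewrite -fA -fB -invg_comm groupV.
  - move=> n; rewrite -fA -fB -invg_comm !expgVn => /eqP.
    by rewrite invg_eq1 => /eqP; apply: fP.
  move=> Prs _.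
  have AP n : P %| n -> A ^+ n \in macdonald_der P A B.
    by case/dvdnP=> k ->; rewrite mulnC expgM groupX // mem_gen // !inE eqxx.
  have BP n : P %| n -> B ^+ n \in macdonald_der P A B.
    by case/dvdnP=> k ->;
      rewrite mulnC expgM groupX // mem_gen // !inE eqxx orbT.
  have nMX h k v : h \in G -> v \in macdonald_der P A B -> v ^ (h ^+ k) \in
    macdonald_der P A B.
    move=> Gh Mv; rewrite memJ_norm // groupX //.
    by apply: (subsetP (normal_norm (macdonald_der_normal oddP relAB))).
  have nuE k l v h h' : h \in G -> h' \in G -> v \in macdonald_der P A B ->
      nu (h ^+ k * h' ^+ l * v) = nu h ^+ k * nu h' ^+ l * nu v.
    move=> Gh Gh' Mv; rewrite -(autmE Anu) !morphM ?morphX ?groupM ?groupX //.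
    exact: subsetP (normal_sub (macdonald_der_normal oddP relAB)) v Mv.
  have [[Py Pr xs1] | [Px Ps yr1]] := rigid_exponents p_pr m_ge1 Pxy Prs e.
    rewrite -[f]mulg1 mem_mulg ?group1 //.
    apply: (Aut_diagonal oddP relAB uP oC homH (x := x) (s := s) P_gt1 Af _ _ _
      _ xs1).
    - exact: groupM (BP _ Py) Mz.
    - exact: groupM (nMX B s _ GB (AP _ Pr)) Mw.
    - by rewrite fA mulgA.
    by rewrite fB (conjgC (A ^+ r)) -mulgA.
  (* Here [f * nu] is diagonal: modulo M it sends A to A^y and B to B^r. *)
  have -> : f = f * nu * nu^-1 by rewrite mulgK.
  rewrite mem_mulg ?groupV ?cycle_id //.
  apply: (Aut_diagonal oddP relAB uP oC homH (x := y) (s := r) P_gt1 _ _ _ _ _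
    yr1).
  - exact: groupM.
  - exact: groupM (nMX A y _ GA (BP _ Px)) (Aut_macdonald_der oddP relAB uP oC
    Anu Mz).
  - exact: groupM (AP _ Ps) (Aut_macdonald_der oddP relAB uP oC Anu Mw).
  - by rewrite permM fA nuE // nuA nuB (conjgC (B ^+ x)) -mulgA.
  by rewrite permM fB nuE // nuA nuB mulgA.
split; first by exists nu.
have nu_order : #[nu] = 2.
  apply: nt_prime_order => //; apply: contraNneq nu_nAut3 => ->.
  exact: group1.
(* The involution nu lies outside Aut_3(H), so the factors meet trivially; the order is 2 |M|^2 with
   |M| = P^4. *)
rewrite AutE TI_cardMg.
  rewrite -orderE nu_order (card_Aut3 oddP relAB uP oC homH).
  rewrite (card_macdonald_der oddP relAB uP oC) mulnC -!expnM;
    congr (2 * p ^ _)%N.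
  by lia.
by rewrite setIC; apply: prime_TIg; rewrite -?orderE ?nu_order // cycle_subG.
Qed.
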